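(* Let $f,h:X\to\mathbb{R}\cup\{\infty\}$ satisfy the standing assumptions in the context. Let $\alpha_k\in[0,1]$, $k=0,1,2,\dots$, and let $(v_k,y_k,z_k)$, $k=0,1,2,\dots$, be the iterates generated by the generalized mirror descent algorithm (defined in the context) with step sizes $\alpha_k$, started from $v_0\in\operatorname{dom}(\partial h^* )$. If $\alpha_0=1$, then for all $k=1,2,\dots$ $$\sum_{i=0}^{k-1}\lambda_i^k\bigl(f(y_i)+h(y_i)\bigr)-\sum_{i=0}^{k-1}\mu_i^k\,\mathcal{D}_{h^*,\tilde f^*}(v_i,-z_i,\alpha_i)=-f^*(-v_k)-h^*(v_k).$$ In particular, for all $k=1,2,\dots$ $$\sum_{i=0}^{k-1}\lambda_i^k\bigl(f(y_i)+h(y_i)\bigr)+f^*(-v_k)+h^*(v_k)\le\sum_{i=0}^{k-1}\mu_i^k\,D_{h^*}(v_{i+1},v_i).$$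
   Context: Setting. $X$ is a finite-dimensional real vector space with dual $X^*$ and pairing $\langle\cdot,\cdot\rangle$. $f,h:X\to\mathbb{R}\cup\{\infty\}$ are proper closed convex functions with Fenchel conjugates $f^*,h^*:X^*\to\mathbb{R}\cup\{\infty\}$. $\operatorname{dom}(\partial f)\subseteq X$ and $\operatorname{dom}(\partial h^* )\subseteq X^*$ are the sets of points at which the respective subdifferential is nonempty. Single-valued oracles are fixed: for each $y\in\operatorname{dom}(\partial f)$, $\partial f(y)\in X^*$ denotes one fixed chosen element of $\operatorname{argmax}_{v\in X^*}\{\langle v,y\rangle-f^*(v)\}$ (the subdifferential of $f$ at $y$); for each $u\in\operatorname{dom}(\partial h^* )$, $\partial h^*(u)\in X$ denotes one fixed chosen element of $\operatorname{argmax}_{x\in X}\{\langle u,x\rangle-h(x)\}$ (the subdifferential of $h^*$ at $u$). Standing assumption: $-\partial f(y)\in\operatorname{dom}(\partial h^* )$ for all $y\in\operatorname{dom}(\partial f)$, and $\partial h^*(u)\in\operatorname{dom}(\partial f)$ for all $u\in\operatorname{dom}(\partial h^* )$. Generalized Bregman distance: $D_{h^*}(v,u)=h^*(v)-h^*(u)-\langle v-u,\partial h^*(u)\rangle$ for $u\in\operatorname{dom}(\partial h^* )$, $v\in\operatorname{dom}(h^* )$, with the chosen subgradient $\partial h^*(u)$. Notation: $\tilde f(y):=f(-y)$ (so $\tilde f^*(v)=f^*(-v)$), and $$\mathcal{D}_{h^*,\tilde f^*}(v,-z,\alpha):=D_{h^*}((1-\alpha)v-\alpha z,v)+f^*(-(1-\alpha)v+\alpha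 z)-(1-\alpha)f^*(-v)-\alpha f^*(z),$$ with the convention $0\cdot\infty=0$ (relevant only for $i=0$, $\alpha_0=1$). Generalized mirror descent algorithm: given $v_0\in\operatorname{dom}(\partial h^* )$, for $k=0,1,2,\dots$: $y_k:=\partial h^*(v_k)$, $z_k:=\partial f(y_k)$, $v_{k+1}:=(1-\alpha_k)v_k-\alpha_kz_k$, where $\alpha_k\in[0,1]$. The iterates are understood to be well defined, i.e. $v_k\in\operatorname{dom}(\partial h^* )$ for all $k$. Weights: for $k=0,1,2,\dots$, $\lambda^{k+1}_k=\alpha_k$, $\mu^{k+1}_k=1$, and $\lambda^{k+1}_i=(1-\alpha_k)\lambda^k_i$, $\mu^{k+1}_i=(1-\alpha_k)\mu^k_i$ for $i=0,\dots,k-1$. *)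

(* Defs.v *)
(* MathComp / MathComp-Analysis *)
From HB Require Import structures.
From mathcomp Require Import all_boot all_order all_algebra.
From mathcomp Require Import all_classical all_reals all_analysis.

Set Implicit Arguments.
Unset Strict Implicit.
Unset Printing Implicit Defensive.

Import Order.TTheory GRing.Theory Num.Theory.
Import numFieldNormedType.Exports.

Local Open Scope classical_set_scope.
Local Open Scope ring_scope.
Local Open Scope ereal_scope.

(* The dual of X is 'Hom(X, R^o); the pairing <u, x> is the application u x. *)

Section ConvexFunctions.
Variables (R : realType) (X : vectType R).
Implicit Types (f h : X -> \bar R) (x y : X) (u v z : 'Hom(X, R^o)).

Definition proper f : Prop :=
  (forall x, f x != -oo) /\ (exists x, f x != +oo).

Definition epigraph f : set (X * R^o) := [set p | f p.1 <= p.2%:E].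

(* A vectType carries no topology: X is given its usual finite-dimensional
   topology through the coordinates in a basis. *)
Definition of_coord (c : 'rV[R]_(\dim {:X})) : X :=
  (\sum_i c ord0 i *: (vbasis {:X})`_i)%R.

Definition closed_fun f : Prop :=
  closed [set p : 'rV[R]_(\dim {:X}) * R | epigraph f (of_coord p.1, p.2)].

Definition convex_fun f : Prop := convex_set (epigraph f).

Definition proper_closed_convex f : Prop :=
  [/\ proper f, closed_fun f & convex_fun f].

Definition fenchel f v : \bar R :=
  ereal_sup [set (v x)%:E - f x | x in [set: X]].

Definition argmax (T : Type) (g : T -> \bar R) : set T :=
  [set t | forall s, g s <= g t].

Definition subdiff f y : set 'Hom(X, R^o) :=
  argmax (fun v => (v y)%:E - fenchel f v).

(* The subdifferential of [fenchel h] at u, as a subset of X (not X^** ). *)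
Definition subdiff_fenchel h u : set X :=
  argmax (fun x => (u x)%:E - h x).

Definition dom_subdiff f : set X := [set y | subdiff f y !=set0].

Definition dom_subdiff_fenchel h : set 'Hom(X, R^o) :=
  [set u | subdiff_fenchel h u !=set0].

(* In the next two definitions, dh is the chosen selection of the
   subdifferential of [fenchel h]. *)
Definition bregman h (dh : 'Hom(X, R^o) -> X) v u : \bar R :=
  fenchel h v - fenchel h u - ((v - u)%R (dh u))%:E.

(* The value at (v, -z, a) of the distance associated with h^* and the conjugate
   of y |-> f (- y); in \bar R, 0 * +oo = 0. *)
Definition bregman2 f h (dh : 'Hom(X, R^o) -> X) v z (a : R) : \bar R :=
  bregman h dh ((1 - a) *: v - a *: z)%R v
  + fenchel f (- ((1 - a) *: v) + a *: z)%R
  - (1 - a)%:E * fenchel f (- v)%R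
  - a%:E * fenchel f z.

Definition mirror_descent h (df : X -> 'Hom(X, R^o)) (dh : 'Hom(X, R^o) -> X)
    (alpha : nat -> R) (v : nat -> 'Hom(X, R^o)) (y : nat -> X)
    (z : nat -> 'Hom(X, R^o)) : Prop :=
  forall k : nat, [/\ dom_subdiff_fenchel h (v k),
    y k = dh (v k),
    z k = df (y k) &
    v k.+1 = ((1 - alpha k) *: v k - alpha k *: z k)%R].

End ConvexFunctions.

(* [lambda alpha k i] and [mu alpha k i] are meaningful for i < k only. *)
Fixpoint lambda (R : realType) (alpha : nat -> R) (k i : nat) : R :=
  if k is k'.+1 then
    if i == k' then alpha k' else ((1 - alpha k') * lambda alpha k' i)%R
  else 0%R.

Fixpoint mu (R : realType) (alpha : nat -> R) (k i : nat) : R :=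
  if k is k'.+1 then
    if i == k' then 1%R else ((1 - alpha k') * mu alpha k' i)%R
  else 0%R.

(* Main.v *)
(* With every quantity finite, the Young equalities f(y) + f^*(z) = <z, y> and
   h(y) + h^*(v) = <v, y> turn each weighted Bregman term into
     alpha (f + h)(y) + Phi(v_{i+1}) - (1 - alpha) Phi(v_i),
   where Phi(v) = f^*(-v) + h^*(v), so that the weighted sums telescope.
   The first equality rests on f^** >= f: the strict separation of a point from
   the epigraph by its nearest point yields an affine minorant, and a vertical
   hyperplane is tilted by a large multiple of itself added to some
   non-vertical minorant.  Convexity of f^* gives the inequality. *)
Require Import Defs.
From HB Require Import structures.
From mathcomp Require Import all_boot all_order all_algebra.
From mathcomp Require Import all_classical all_reals all_analysis.
From mathcomp Require Import ring lra.
Import Order.TTheory GRing.Theory Num.Theory.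
Import numFieldNormedType.Exports.
Local Open Scope classical_set_scope.
Local Open Scope ring_scope.

(** * Nearest points for the Euclidean inner product [pair_dot] on R^n x R *)

Definition pair_dot {R : realType} {n} (p q : 'rV[R]_n * R) : R :=
  \sum_i p.1 0 i * q.1 0 i + p.2 * q.2.

Lemma pair_dot_ge0 {R : realType} {n} (p : 'rV[R]_n * R) : 0 <= pair_dot p p.
Proof. by rewrite addr_ge0 ?sumr_ge0// => *; rewrite -expr2 sqr_ge0. Qed.

Lemma sqr_coord_le_pair_dot {R : realType} {n} (p : 'rV[R]_n * R) i :
  p.1 0 i ^+ 2 <= pair_dot p p.
Proof.
rewrite /pair_dot (bigD1 i)//= -addrA expr2 lerDl addr_ge0//.
  by rewrite sumr_ge0// => *; rewrite -expr2 sqr_ge0.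
by rewrite -expr2 sqr_ge0.
Qed.

Lemma sqr_snd_le_pair_dot {R : realType} {n} (p : 'rV[R]_n * R) :
  p.2 ^+ 2 <= pair_dot p p.
Proof. by rewrite lerDr sumr_ge0// => *; rewrite -expr2 sqr_ge0. Qed.

Lemma continuous_sqdist {R : realType} {n} (p : 'rV[R]_n * R) :
  continuous (fun q : 'rV[R]_n * R => pair_dot (p - q) (p - q)).
Proof.
rewrite (_ : (fun q => _) = fun q : 'rV[R]_n * R =>
    \sum_i (p.1 0 i - q.1 0 i) * (p.1 0 i - q.1 0 i) + (p.2 - q.2) * (p.2 - q.2)); last first.
  by apply/funext => q; congr (_ + _); apply: eq_bigr => i _; rewrite !mxE.
have sumC : continuous (fun q : 'rV[R]_n * R =>
    \sum_i (p.1 0 i - q.1 0 i) * (p.1 0 i - q.1 0 i)).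
  apply: continuous_big => [|i _ q]; first exact: add_continuous.
  have h : ((x : 'rV[R]_n * R).1 0 i @[x --> q] --> q.1 0 i)%classic.
    apply: (@cvg_comp _ _ _ fst (fun M : 'rV[R]_n => M 0 i)); first exact: cvg_fst.
    exact: coord_continuous.
  by apply: cvgM; apply: cvgB => //; exact: cvg_cst.
move=> q; apply: cvgD; first exact: sumC.
by apply: cvgM; apply: cvgB; [exact: cvg_cst|exact: cvg_snd|
  exact: cvg_cst|exact: cvg_snd].
Qed.

(** Only points of [K] no farther from [p] than a fixed [q0] compete; they lie in a compact box,
    where the continuous squared distance attains its minimum. *)
Lemma closed_nearest {R : realType} {n} (K : set ('rV[R]_n * R)) p :
  closed K -> K !=set0 ->
  exists2 c, K c & forall q, K q -> pair_dot (p - c) (p - c) <= pair_dot (p - q) (p - q).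
Proof.
move=> Kcl [q0 Kq0].
set Q := fun q : 'rV[R]_n * R => pair_dot (p - q) (p - q).
(* Since [M >= 1], a square at most [Q q0 < M <= M ^+ 2] has a root of size at most [M]: the box
   needs no square root. *)
set M := Q q0 + 1.
have Q0 q : 0 <= Q q by exact: pair_dot_ge0.
have M1 : 1 <= M by rewrite lerDr.
pose B := [set u : 'rV[R]_n | forall i, `[p.1 0 i - M, p.1 0 i + M]%classic (u 0 i)]
  `*` `[p.2 - M, p.2 + M]%classic.
have Bc : compact B.
  apply: compact_setX; last exact: segment_compact.
  by apply: (@rV_compact _ _ (fun i => `[p.1 0 i - M, p.1 0 i + M]%classic)) => i; exact: segment_compact.
have inB q : Q q <= Q q0 -> B q.
  move=> Qq.
  have aux (x y : R) : (x - y) ^+ 2 <= Q q -> `[x - M, x + M]%classic y.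
    move=> h; have {Qq}h := le_trans h Qq; have q00 := Q0 q0.
    by rewrite /= in_itv/= /M; apply/andP; split; nra.
  split=> [i|]; apply: aux.
    by have := sqr_coord_le_pair_dot (p - q) i; rewrite /= !mxE.
  by have := sqr_snd_le_pair_dot (p - q).
have [|||c] := @compact_EVT_min _ _ Q (B `&` K).
- by exists q0; split => //; exact: inB.
- exact: compact_closedI.
- exact/continuous_subspaceT/continuous_sqdist.
rewrite inE => -[_ Kc] cmin; exists c => // q Kq.
have [Qq|/ltW Qq] := leP (Q q) (Q q0); first by apply: cmin; rewrite inE; split => //; exact: inB.
by apply: le_trans Qq; apply: cmin; rewrite inE; split => //; exact: inB.
Qed.

(** Moving from [c] towards [q] by a fraction [t] changes the squared distance to [p] by
    [- 2 t A + t^2 B], which would be negative for small [t] if [A] were positive. *)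
Lemma nearest_variational {R : realType} {n} (K : set ('rV[R]_n * R)) p c :
  (forall q r t, K q -> K r -> 0 <= t <= 1 ->
    K ((1 - t) *: q.1 + t *: r.1, (1 - t) * q.2 + t * r.2)) ->
  K c -> (forall q, K q -> pair_dot (p - c) (p - c) <= pair_dot (p - q) (p - q)) ->
  forall q, K q -> pair_dot (p - c) (q - c) <= 0.
Proof.
move=> Kconv Kc cmin q Kq; rewrite leNgt; apply/negP.
set A := pair_dot _ _ => A0.
have := pair_dot_ge0 (q - c); set B := pair_dot _ _ => B0.
(* This choice gives both [t <= 1] and [t * B < A]. *)
pose t := A / (A + B + 1).
have d0 : 0 < A + B + 1 by lra.
have t0 : 0 < t by rewrite divr_gt0.
have t1 : t <= 1 by rewrite ler_pdivrMr//; lra.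
have tE : t * (A + B + 1) = A by rewrite divfK// gt_eqF.
have := cmin _ (Kconv _ _ t Kc Kq _); rewrite (ltW t0) t1 => /(_ isT).
set m := (_, _); have -> : pair_dot (p - m) (p - m) =
    pair_dot (p - c) (p - c) - (t * 2) * A + t ^+ 2 * B.
  have sumE : \sum_i (p - m).1 0 i * (p - m).1 0 i =
      \sum_i (p - c).1 0 i * (p - c).1 0 i
      - (t * 2) * \sum_i (p - c).1 0 i * (q - c).1 0 i
      + t ^+ 2 * \sum_i (q - c).1 0 i * (q - c).1 0 i.
    rewrite 2!mulr_sumr -sumrB -big_split/=.
    by apply: eq_bigr => i _; rewrite !mxE; ring.
  by rewrite /A /B /pair_dot sumE /=; ring.
have : t * B < A by nra.
nra.
Qed.

(** * Separation from the epigraph and affine minorants *)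

Section Duality.
Context {R : realType} {X : vectType R}.
Implicit Types (f h : X -> \bar R) (u v w z : 'Hom(X, R^o)).

Lemma of_coord_surj (x : X) : exists c, of_coord c = x.
Proof.
exists (\row_i coord (vbasis {:X}) i x).
rewrite /of_coord [RHS](coord_vbasis (memvf x)).
by apply: eq_bigr => i _; rewrite mxE.
Qed.

Lemma of_coord_comb (a b : R) c d :
  of_coord (a *: c + b *: d) = a *: of_coord c + b *: of_coord d :> X.
Proof.
rewrite /of_coord !scaler_sumr -big_split/=; apply: eq_bigr => i _.
by rewrite !mxE scalerDl !scalerA.
Qed.

(** Carries a normal vector found in coordinates back to an element of the dual of [X]. *)
Lemma of_coord_dual (w : 'rV[R]_(\dim {:X})) :
  exists v, forall c, v (of_coord c) = \sum_i w 0 i * c 0 i.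
Proof.
exists (\sum_i w 0 i *: linfun (coord (vbasis {:X}) i)) => c.
rewrite sum_lfunE; apply: eq_bigr => i _; rewrite lfunE/= lfunE/=; congr (_ * _).
rewrite /of_coord linear_sum/= (bigD1 i)//= linearZ/= coord_free ?(basis_free (vbasisP _))//.
rewrite eqxx mulr1 big1 ?addr0// => j ji.
by rewrite linearZ/= coord_free ?(basis_free (vbasisP _))// (negbTE ji) mulr0.
Qed.

Lemma epigraph_comb f (x y : X) (s r t : R) : convex_fun f ->
  (f x <= s%:E)%E -> (f y <= r%:E)%E -> 0 <= t <= 1 ->
  (f ((1 - t) *: x + t *: y)%R <= ((1 - t) * s + t * r)%:E)%E.
Proof.
move=> fconv fx fy /andP[t0 t1].
(* The points are swapped because [convex_set] puts the weight [t] on the first one. *)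
have := fconv (y, r) (x, s) (Itv01 t0 t1).
rewrite !inE => /(_ fy fx); rewrite /epigraph /=.
by rewrite (addrC ((1 - t) *: x)) (addrC ((1 - t) * s)).
Qed.

(** The normal [(v, s)] points from the nearest point [c] of the epigraph to [(a, b)], and [m] is
    the value of the functional at [c]. *)
Lemma epigraph_separation f (a : X) (b : R) :
  closed_fun f -> convex_fun f -> (exists x, f x != +oo%E) ->
  (b%:E < f a)%E ->
  exists v (s m : R), (forall x t, (f x <= t%:E)%E -> v x + s * t <= m) /\ m < v a + s * b.
Proof.
move=> fcl fconv [x0 fx0] fab.
pose K := [set p : 'rV[R]_(\dim {:X}) * R | epigraph f (of_coord p.1, p.2)].
have [ca caE] := of_coord_surj a.
have K0 : K !=set0.
  have [c0 c0E] := of_coord_surj x0.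
  exists (c0, fine (f x0)); rewrite /K /epigraph /= c0E.
  by case: (f x0) fx0 => //= *; rewrite leNye.
have [c Kc cmin] := closed_nearest K (ca, b) fcl K0.
have Kconv q r t : K q -> K r -> 0 <= t <= 1 ->
    K ((1 - t) *: q.1 + t *: r.1, (1 - t) * q.2 + t * r.2).
  by move=> Kq Kr t01; rewrite /K /epigraph /= of_coord_comb; exact: epigraph_comb.
have var := nearest_variational K _ _ Kconv Kc cmin.
have [v vE] := of_coord_dual (ca - c.1).
set s := b - c.2.
have dotE d (t : R) : pair_dot ((ca, b) - c) ((d, t) - c) =
    v (of_coord d) + s * t - (v (of_coord c.1) + s * c.2).
  rewrite /pair_dot /= !vE.
  have -> : \sum_i (ca - c.1) 0 i * (d - c.1) 0 i =
      \sum_i (ca - c.1) 0 i * d 0 i - \sum_i (ca - c.1) 0 i * c.1 0 i.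
    by rewrite -sumrB; apply: eq_bigr => i _; rewrite !mxE; ring.
  by rewrite /s; ring.
exists v, s, (v (of_coord c.1) + s * c.2); split=> [x t fxt|].
  have [d dE] := of_coord_surj x.
  have /var : K (d, t) by rewrite /K /epigraph /= dE.
  by rewrite dotE dE subr_le0.
(* The gap is the squared distance from [(ca, b)] to [c]; were it zero, [(a, b)] would lie in the
   epigraph. *)
rewrite -subr_gt0 -caE -dotE lt_neqAle pair_dot_ge0 andbT.
apply/eqP => /esym d0.
have cab : (ca, b) = c.
  apply/eqP; rewrite -subr_eq0; apply/eqP; set e := (ca, b) - c in d0 *.
  have e1 i : e.1 0 i = 0.
    by apply/eqP; rewrite -sqrf_eq0 eq_le sqr_ge0 -d0 sqr_coord_le_pair_dot.
  have e2 : e.2 = 0.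
    by apply/eqP; rewrite -sqrf_eq0 eq_le sqr_ge0 -d0 sqr_snd_le_pair_dot.
  have e1' : e.1 = 0 by apply/rowP => i; rewrite e1 mxE.
  by rewrite (surjective_pairing e) e1' e2.
by move: Kc; rewrite -cab /K /epigraph /= caE leNgt fab.
Qed.

(** Testing real heights [t] above the graph keeps the arithmetic in [R]; a point where [f] is [+oo]
    contributes [-oo] to the supremum. *)
Lemma fenchel_le f v (m : R) :
  (forall x t, (f x <= t%:E)%E -> v x - t <= m) -> (forall x, f x != -oo%E) ->
  (fenchel f v <= m%:E)%E.
Proof.
move=> fm fNy; apply: ge_ereal_sup => _ [x _ <-].
case: (f x) (fm x) (fNy x) => [r h _|_ _|//]; last by rewrite /= leNye.
by rewrite -EFinB lee_fin h.
Qed.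

Lemma le_of_fenchel_le f v (m : R) x (t : R) :
  (fenchel f v <= m%:E)%E -> (f x <= t%:E)%E -> v x - t <= m.
Proof.
move=> vm fxt; rewrite -lee_fin EFinB; apply: le_trans vm.
apply: (@le_trans _ _ ((v x)%:E - f x)%E); first by rewrite leeB.
by apply: ereal_sup_ubound; exists x.
Qed.

(** Dividing by [- s > 0] turns the hyperplane into a graph. The bound on [fenchel f u] says that
    the affine function of slope [u] through [(a, b)] minorizes [f]. *)
Lemma nonvertical_minorant f (a : X) (b : R) v (s m : R) :
  (forall x, f x != -oo%E) -> s < 0 ->
  (forall x t, (f x <= t%:E)%E -> v x + s * t <= m) -> m < v a + s * b ->
  exists u, (fenchel f u <= (u a - b)%:E)%E.
Proof.
move=> fNy s0 sep ab; exists ((- s)^-1 *: v).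
have s1 : 0 < (- s)^-1 by rewrite invr_gt0 oppr_gt0.
have e (y : R) : y = (- s)^-1 * (- s * y) by rewrite mulKf// gt_eqF ?oppr_gt0.
apply: fenchel_le => // x t /sep xt; rewrite !lfunE/= [t]e [b]e -!mulrBr.
by rewrite ler_pM2l//; lra.
Qed.

(** The epigraph is unbounded upwards, so a positive [s] would violate any upper bound. *)
Lemma epigraph_slope_le0 f v (s m : R) :
  (exists x, f x != +oo%E) ->
  (forall x t, (f x <= t%:E)%E -> v x + s * t <= m) -> s <= 0.
Proof.
move=> [x fx] sep; rewrite leNgt; apply/negP => s0.
(* The rise [d] makes [s * d] exceed the slack left at height [r]. If [f x] is [-oo], [fine] gives
   0, which is still above the graph. *)
set r := fine (f x); set d := (`|m - v x - s * r| + 1) / s.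
have d0 : 0 <= d by rewrite divr_ge0 ?addr_ge0// ltW.
have fxr : (f x <= (r + d)%:E)%E.
  rewrite /r; case: (f x) fx => [q _||_] /=; rewrite ?leNye// lee_fin.
  by rewrite lerDl.
have dE : s * d = `|m - v x - s * r| + 1 by rewrite mulrC divfK// gt_eqF.
have := sep _ _ fxr; rewrite mulrDr dE.
have := ler_norm (m - v x - s * r); lra.
Qed.

Lemma affine_minorant f (a : X) (b : R) :
  proper_closed_convex f -> (b%:E < f a)%E ->
  exists u, (fenchel f u <= (u a - b)%:E)%E.
Proof.
move=> [[fNy fy] fcl fconv] fab.
have [v [s [m [sep mab]]]] := epigraph_separation f a b fcl fconv fy fab.
have := epigraph_slope_le0 f v s m fy sep; rewrite le_eqVlt => /predU1P[s0|s0]; last first.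
  exact: nonvertical_minorant mab.
have [x1 /eqP fx1] := fy.
have [r1 fx1E] : exists r, f x1 = r%:E.
  by move: fx1 (fNy x1); case: (f x1) => // r _ _; exists r.
have fx1lt : ((r1 - 1)%:E < f x1)%E by rewrite fx1E lte_fin; lra.
have [v1 [s1 [m1 [sep1 mab1]]]] := epigraph_separation f x1 (r1 - 1) fcl fconv fy fx1lt.
(* Below a point with a finite value the separation cannot be vertical: with [s1 = 0] the point
   [(x1, r1)] of the epigraph would violate it. *)
have s10 : s1 < 0.
  rewrite lt_neqAle (epigraph_slope_le0 f v1 s1 m1)// andbT.
  apply/eqP => s1E; have /sep1 : (f x1 <= r1%:E)%E by rewrite fx1E.
  by move: mab1; rewrite s1E !mul0r ltNge => /negP.
have [u1 u1C] := nonvertical_minorant f x1 (r1 - 1) v1 s1 m1 fNy s10 sep1 mab1.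
set C := u1 x1 - (r1 - 1) in u1C.
move: mab; rewrite s0 mul0r addr0 -subr_gt0 => mva.
(* [M] is large enough that [C + M * m <= u1 a + M * v a - b], the bound required of the tilted
   slope. *)
set M := `|C - u1 a + b| / (v a - m).
have M0 : 0 <= M by rewrite divr_ge0// ltW.
have ME : M * (v a - m) = `|C - u1 a + b| by rewrite divfK// gt_eqF.
exists (u1 + M *: v); apply: fenchel_le => // x t fxt.
have h1 := le_of_fenchel_le f u1 C x t u1C fxt.
have := sep _ _ fxt; rewrite s0 mul0r addr0 => h2.
rewrite !lfunE/= !lfunE/=.
have := ler_norm (C - u1 a + b); rewrite -ME.
have : M * v x <= M * m by rewrite ler_wpM2l.
rewrite /GRing.scale/=; lra.
Qed.

(** * Young equalities and convexity of the conjugate *)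

Lemma fenchel_neqNy f v : Defs.proper f -> fenchel f v != -oo%E.
Proof.
move=> [fNy [x fx]]; rewrite -ltNye.
apply: (@lt_le_trans _ _ ((v x)%:E - f x)%E); last first.
  by apply: ereal_sup_ubound; exists x.
by move: fx (fNy x); case: (f x) => // r _ _; rewrite -EFinB ltNyr.
Qed.

(* The Fenchel-Moreau theorem enters here: [subdiff f y] only says that z
   attains the supremum defining the biconjugate of f at y. *)
Lemma subdiff_young f y z : proper_closed_convex f -> subdiff f y z ->
  exists F G : R, [/\ f y = F%:E, fenchel f z = G%:E & F + G = z y].
Proof.
move=> fpcc zmax; have fprop : Defs.proper f by case: fpcc.
(* Compare [z] with the slope [u] of an affine minorant through [(y, b)]: maximality gives [z y -
   fenchel f z >= u y - fenchel f u >= b]. *)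
have below b : (b%:E < f y)%E -> (fenchel f z <= (z y - b)%:E)%E.
  move=> /(affine_minorant _ _ _ fpcc)[u ub].
  have := zmax u; have := fenchel_neqNy f u fprop; have := fenchel_neqNy f z fprop.
  case: (fenchel f u) ub => [p||_ _ /eqP//]; last by rewrite leye_eq.
  rewrite lee_fin => ub; case: (fenchel f z) => //= q _ _.
  by rewrite -!EFinB !lee_fin; lra.
have [G zG] : exists G, fenchel f z = G%:E.
  have [b /below] : exists b, (b%:E < f y)%E.
    have := fprop.1 y; case: (f y) => [r _|_|//]; last by exists 0; rewrite ltey.
    by exists (r - 1); rewrite lte_fin; lra.
  by have := fenchel_neqNy f z fprop; case: (fenchel f z) => // G _ _; exists G.
have := fprop.1 y; case fyE : (f y) below => [F|//|//] below _; last first.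
  (* If [f y] were [+oo], this height would yield [G <= G - 1]. *)
  have := below (z y - G + 1) (ltey _); rewrite zG lee_fin => h; clear -h; lra.
exists F, G; split => //; apply/eqP; rewrite eq_le; apply/andP; split.
  rewrite leNgt; apply/negP => lt.
  (* The height is the midpoint of [z y - G] and [F], while [below] forbids heights above
     [z y - G]. *)
  have := below ((F + z y - G) / 2); rewrite lte_fin zG lee_fin => h.
  have mid : (F + z y - G) / 2 < F by clear -lt; lra.
  by have := h mid; clear -lt; lra.
have := le_of_fenchel_le f z G y F; rewrite zG fyE => /(_ (lexx _) (lexx _)).
by rewrite lerBlDr addrC.
Qed.

(** Here [x] attains the supremum defining [fenchel h u] itself, so no biconjugate intervenes;
    comparison with a point of finite value makes [h x] finite. *)
Lemma subdiff_fenchel_young h u x : Defs.proper h -> subdiff_fenchel h u x ->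
  exists G H : R, [/\ h x = H%:E, fenchel h u = G%:E & G + H = u x].
Proof.
move=> [hNy [x0 hx0]] xmax.
have hux : fenchel h u = ((u x)%:E - h x)%E.
  apply/eqP; rewrite eq_le; apply/andP; split.
    by apply: ge_ereal_sup => _ [y _ <-]; exact: xmax.
  by apply: ereal_sup_ubound; exists x.
have [H hxE] : exists H, h x = H%:E.
  have := xmax x0; have := hNy x; case: (h x) => [H _ _|_|//]; first by exists H.
  by move: hx0 (hNy x0); case: (h x0).
by exists (u x - H), H; rewrite hux hxE subrK.
Qed.

(** The conjugate is a supremum of affine functions of [v]; real bounds [A] and [B] avoid extended
    arithmetic. *)
Lemma fenchel_convex f v w (A B t : R) : Defs.proper f -> 0 <= t <= 1 ->
  (fenchel f v <= A%:E)%E -> (fenchel f w <= B%:E)%E ->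
  (fenchel f ((1 - t) *: v + t *: w)%R <= ((1 - t) * A + t * B)%:E)%E.
Proof.
move=> [fNy _] /andP[t0 t1] vA wB; apply: fenchel_le => // x r fxr.
have := le_of_fenchel_le f v A x r vA fxr; have := le_of_fenchel_le f w B x r wB fxr.
rewrite !lfunE/= !lfunE/= /GRing.scale/=; nra.
Qed.

End Duality.

(** * Recursions for the weights, and the telescoping *)

Lemma lambda_sum_recr {R : realType} (alpha c : nat -> R) k :
  \sum_(i < k.+1) lambda alpha k.+1 i * c i =
  (1 - alpha k) * (\sum_(i < k) lambda alpha k i * c i) + alpha k * c k.
Proof.
rewrite big_ord_recr /= eqxx mulr_sumr; congr (_ + _).
by apply: eq_bigr => i _; rewrite (ltn_eqF (ltn_ord i)) mulrA.
Qed.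

Lemma mu_sum_recr {R : realType} (alpha c : nat -> R) k :
  \sum_(i < k.+1) mu alpha k.+1 i * c i =
  (1 - alpha k) * (\sum_(i < k) mu alpha k i * c i) + c k.
Proof.
rewrite big_ord_recr /= eqxx mulr_sumr mul1r; congr (_ + _).
by apply: eq_bigr => i _; rewrite (ltn_eqF (ltn_ord i)) mulrA.
Qed.

Lemma mu_ge0 {R : realType} (alpha : nat -> R) k i :
  (forall j, 0 <= alpha j <= 1) -> 0 <= mu alpha k i.
Proof.
move=> alpha01; elim: k => //= k IHk; case: ifP => // _.
by rewrite mulr_ge0// subr_ge0; case/andP: (alpha01 k).
Qed.

Local Open Scope ereal_scope.

Theorem corollary2 (R : realType) (X : vectType R) (f h : X -> \bar R)
    (df : X -> 'Hom(X, R^o)) (dh : 'Hom(X, R^o) -> X)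
    (alpha : nat -> R)
    (v : nat -> 'Hom(X, R^o)) (y : nat -> X) (z : nat -> 'Hom(X, R^o))
    (f_pcc : proper_closed_convex f)
    (h_pcc : proper_closed_convex h)
    (df_oracle : forall x, dom_subdiff f x -> subdiff f x (df x))
    (dh_oracle : forall u, dom_subdiff_fenchel h u ->
       subdiff_fenchel h u (dh u))
    (df_dom : forall x, dom_subdiff f x -> dom_subdiff_fenchel h (- df x)%R)
    (dh_dom : forall u, dom_subdiff_fenchel h u -> dom_subdiff f (dh u))
    (alpha01 : forall k, (0 <= alpha k <= 1)%R)
    (iterates : mirror_descent h df dh alpha v y z)
    (alpha0 : alpha 0%N = 1%R) :
  (forall k : nat, (0 < k)%N ->
    \sum_(i < k) (lambda alpha k i)%:E * (f (y i) + h (y i))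
    - \sum_(i < k) (mu alpha k i)%:E * bregman2 f h dh (v i) (z i) (alpha i)
    = - fenchel f (- v k)%R - fenchel h (v k))
  /\
  (forall k : nat, (0 < k)%N ->
    \sum_(i < k) (lambda alpha k i)%:E * (f (y i) + h (y i))
    + fenchel f (- v k)%R + fenchel h (v k)
    <= \sum_(i < k) (mu alpha k i)%:E * bregman h dh (v i.+1) (v i)).
Proof.
have hprop : Defs.proper h by case: h_pcc.
have fprop : Defs.proper f by case: f_pcc.
have vE k : v k.+1 = ((1 - alpha k) *: v k - alpha k *: z k)%R by case: (iterates k).
pose F i := fine (f (y i)); pose G i := fine (fenchel f (z i)).
pose H i := fine (h (y i)); pose Hs i := fine (fenchel h (v i)).
(* At [i = 0] the conjugate may be [+oo], and [P 0] is then the default 0; it only occurs with the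
   factor [1 - alpha 0 = 0]. *)
pose P i := fine (fenchel f (- v i)%R).
have youngf i : [/\ f (y i) = (F i)%:E, fenchel f (z i) = (G i)%:E &
    (F i + G i = z i (y i))%R].
  have [vi yi zi _] := iterates i.
  have [|F0 [G0 [fF zG FG]]] := subdiff_young f (y i) (z i) f_pcc.
    by rewrite zi yi; exact/df_oracle/dh_dom.
  by rewrite /F /G fF zG.
have youngh i : [/\ h (y i) = (H i)%:E, fenchel h (v i) = (Hs i)%:E &
    (Hs i + H i = v i (y i))%R].
  have [vi yi _ _] := iterates i.
  have [|G0 [H0 [hH vG GH]]] := subdiff_fenchel_young h (v i) (y i) hprop.
    by rewrite yi; exact: dh_oracle.
  by rewrite /H /Hs hH vG.
have fE i : f (y i) = (F i)%:E by case: (youngf i).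
have zE i : fenchel f (z i) = (G i)%:E by case: (youngf i).
have Ff i : (F i + G i = z i (y i))%R by case: (youngf i).
have hE i : h (y i) = (H i)%:E by case: (youngh i).
have hsE i : fenchel h (v i) = (Hs i)%:E by case: (youngh i).
have Hh i : (Hs i + H i = v i (y i))%R by case: (youngh i).
(* Finiteness propagates: convexity bounds the next value above and properness excludes [-oo]. The
   first alternative starts the induction, since [- v 1 = z 0]. *)
have Pstep i : (1 - alpha i = 0)%R \/ fenchel f (- v i)%R = (P i)%:E ->
    fenchel f (- v i.+1)%R = (P i.+1)%:E /\
    (P i.+1 <= (1 - alpha i) * P i + alpha i * G i)%R.
  have -> : (- v i.+1 = (1 - alpha i) *: - v i + alpha i *: z i)%R.
    by rewrite vE opprB scalerN addrC.
  move=> Pi.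
  have le : fenchel f ((1 - alpha i) *: - v i + alpha i *: z i)%R <=
      ((1 - alpha i) * P i + alpha i * G i)%:E.
    case: Pi => [a1|Pi]; last by apply: fenchel_convex; rewrite ?Pi ?zE.
    rewrite a1 scale0r mul0r !add0r.
    have -> : alpha i = 1%R by move/eqP: a1; rewrite subr_eq0 => /eqP.
    by rewrite scale1r mul1r zE.
  have Pfin : fenchel f (- v i.+1)%R = (P i.+1)%:E.
    rewrite /P vE opprB addrC -scalerN.
    move: le (fenchel_neqNy f ((1 - alpha i) *: - v i + alpha i *: z i)%R fprop).
    by case: (fenchel f _).
  move: Pfin; rewrite vE opprB addrC -scalerN => Pfin; split=> //.
  by rewrite -lee_fin -Pfin.
have PE i : (1 - alpha i = 0)%R \/ fenchel f (- v i)%R = (P i)%:E.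
  elim: i => [|i /Pstep[Pi _]]; first by left; rewrite alpha0 subrr.
  by right.
have P1 i : fenchel f (- v i.+1)%R = (P i.+1)%:E by have [] := Pstep i (PE i).
have Ple i : (P i.+1 <= (1 - alpha i) * P i + alpha i * G i)%R.
  by have [] := Pstep i (PE i).
(* [B i] comes from [v i.+1 - v i = - alpha i (v i + z i)], with the pairings with [y i] replaced
   through the Young equalities. *)
pose B i := (Hs i.+1 - Hs i + alpha i * (Hs i + H i + F i + G i))%R.
pose D i := (B i + P i.+1 - (1 - alpha i) * P i - alpha i * G i)%R.
have BE i : bregman h dh (v i.+1) (v i) = (B i)%:E.
  have [_ yi _ _] := iterates i.
  rewrite /bregman -yi !hsE -!EFinB; congr (_%:E).
  rewrite vE !lfunE/= !lfunE/= !lfunE/= !lfunE/=.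
  by rewrite /B /GRing.scale/= -Hh -Ff; ring.
have DE i : bregman2 f h dh (v i) (z i) (alpha i) = (D i)%:E.
  have wE : (1 - alpha i)%:E * fenchel f (- v i)%R = ((1 - alpha i) * P i)%:E.
    by case: (PE i) => [->|->]; rewrite ?mul0e ?mul0r.
  have NvE : (- ((1 - alpha i) *: v i) + alpha i *: z i = - v i.+1)%R.
    by rewrite vE opprB addrC.
  by rewrite /bregman2 -vE NvE BE wE zE P1 -EFinM -!(EFinB, EFinD).
pose S k := (\sum_(i < k) lambda alpha k i * (F i + H i))%R.
pose T k := (\sum_(i < k) mu alpha k i * D i)%R.
have SE k : \sum_(i < k) (lambda alpha k i)%:E * (f (y i) + h (y i)) = (S k)%:E.
  by rewrite -sumEFin; apply: eq_bigr => i _; rewrite fE hE.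
have TE k : \sum_(i < k) (mu alpha k i)%:E * bregman2 f h dh (v i) (z i) (alpha i) =
    (T k)%:E.
  by rewrite -sumEFin; apply: eq_bigr => i _; rewrite DE.
have key k : (S k.+1 - T k.+1 = - P k.+1 - Hs k.+1)%R.
  (* The hypothesis carries the factor [1 - alpha j] so that it holds trivially at [j = 0], where
     the identity itself may fail. *)
  have step j : ((1 - alpha j) * (S j - T j) = (1 - alpha j) * (- P j - Hs j) ->
      S j.+1 - T j.+1 = - P j.+1 - Hs j.+1)%R.
    move=> IH; rewrite (lambda_sum_recr alpha (fun i => F i + H i)%R j : S j.+1 = _).
    rewrite (mu_sum_recr alpha D j : T j.+1 = _) -/(S j) -/(T j).
    transitivity ((1 - alpha j) * (S j - T j) + alpha j * (F j + H j) - D j)%R.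
      by ring.
    by rewrite IH /D /B; ring.
  elim: k => [|k IHk]; first by apply: step; rewrite alpha0 subrr !mul0r.
  by apply: step; rewrite IHk.
split=> -[//|k] _; rewrite SE.
  by rewrite TE P1 hsE -!EFinB key.
have -> : \sum_(i < k.+1) (mu alpha k.+1 i)%:E * bregman h dh (v i.+1) (v i) =
    (\sum_(i < k.+1) mu alpha k.+1 i * B i)%R%:E.
  by rewrite -sumEFin; apply: eq_bigr => i _; rewrite BE.
rewrite P1 hsE -!EFinD lee_fin.
(* By the equality the left side is [T k.+1]; then [D i <= B i] by [Ple], and the weights are
   nonnegative. *)
have -> : (S k.+1 + P k.+1 + Hs k.+1 = T k.+1)%R.
  by have := key k; clear; lra.
apply: ler_sum => i _; rewrite ler_wpM2l ?mu_ge0//.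
by have := Ple i; rewrite /D; clear; lra.
Qed.
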